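(* Let $X\subseteq\{0,1\}^n$, let $Q$ be a real symmetric $n\times n$ matrix with rows $Q_1,\dots,Q_n$, let $\bar X\subseteq\mathbb{R}^n$ be a relaxation of $X$, and let $\gamma^i_{\min}=\min\{Q_i x: x\in\bar X\}$ and $\gamma^i_{\max}=\max\{Q_i x: x\in\bar X\}$. Then for every $x\in X$ and all $i=1,\dots,n$, $$x_i Q_i x=\max\{\gamma^i_{\min}x_i,\; Q_i x+\gamma^i_{\max}x_i-\gamma^i_{\max}\},$$ $$x_i Q_i x=\min\{\gamma^i_{\max}x_i,\; Q_i x+\gamma^i_{\min}x_i-\gamma^i_{\min}\}.$$
   Context: A relaxation of $X$ is a set $\bar X\subseteq\mathbb{R}^n$ with $X\subseteq\bar X$; it is chosen so that the minima and maxima $\gamma^i_{\min},\gamma^i_{\max}$ exist (are attained and finite). $Q_i x$ denotes the scalar product of the $i$-th row of $Q$ with $x$, and $x_iQ_ix$ is the product of the scalars $x_i$ and $Q_ix$. *)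

(* Defs.v *)
From mathcomp Require Import all_boot all_order all_algebra.
From mathcomp Require Import classical_sets reals.

Set Implicit Arguments.
Unset Strict Implicit.
Unset Printing Implicit Defensive.

Import Order.TTheory GRing.Theory Num.Theory.
Local Open Scope classical_set_scope.
Local Open Scope ring_scope.

Definition binary_cube (R : realType) (n : nat) : set 'cV[R]_n :=
  [set x : 'cV[R]_n | forall i, x i 0 = 0 \/ x i 0 = 1].
Arguments binary_cube : clear implicits.

(* Attained extrema, unlike the library's inf and sup, which are total. *)
Definition is_min (R : realType) (A : set R) (m : R) : Prop :=
  A m /\ lbound A m.

Definition is_max (R : realType) (A : set R) (m : R) : Prop :=
  A m /\ ubound A m.

(* The scalar written Q_i x: Q_i is a row vector and x a column vector. *)
Definition row_dot (R : realType) (n : nat) (Q : 'M[R]_n) (i : 'I_n)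
    (x : 'cV[R]_n) : R :=
  (row i Q *m x) 0 0.

(* Main.v *)
Require Import Defs.
From mathcomp Require Import all_boot all_order all_algebra.
From mathcomp Require Import classical_sets reals.

Import Order.TTheory GRing.Theory Num.Theory.
Local Open Scope classical_set_scope.
Local Open Scope ring_scope.

(** Write [q] for [row_dot Q i x]. Since [x] lies in the relaxation, [gmin i <= q <= gmax i]. As
    [x i 0] is 0 or 1, each identity reduces to one of these two bounds: the four expressions are
    the McCormick envelopes of the product of [x i 0] and [q], which are exact when one factor sits
    at an end of its range. *)

Theorem lemma3p1 (R : realType) (n : nat) (X : set 'cV[R]_n) (Q : 'M[R]_n)
    (Xbar : set 'cV[R]_n) (gmin gmax : 'I_n -> R)
    (X_binary : X `<=` binary_cube R n)
    (Q_sym : Q^T = Q)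
    (X_relax : X `<=` Xbar)
    (gminP : forall i : 'I_n,
       is_min [set row_dot Q i x | x in Xbar] (gmin i))
    (gmaxP : forall i : 'I_n,
       is_max [set row_dot Q i x | x in Xbar] (gmax i)) :
  forall x : 'cV[R]_n, X x -> forall i : 'I_n,
    x i 0 * row_dot Q i x =
      Num.max (gmin i * x i 0)
              (row_dot Q i x + gmax i * x i 0 - gmax i) /\
    x i 0 * row_dot Q i x =
      Num.min (gmax i * x i 0)
              (row_dot Q i x + gmin i * x i 0 - gmin i).
Proof.
move=> x Xx i.
have q_in : [set row_dot Q i y | y in Xbar] (row_dot Q i x).
  by exists x => //; exact: X_relax.
have qmin : gmin i <= row_dot Q i x by have [_] := gminP i; exact.
have qmax : row_dot Q i x <= gmax i by have [_] := gmaxP i; exact.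
have [->|->] := X_binary x Xx i.
  (* At 0 the product vanishes, and so do the first arguments; the second ones are [q - gmax i <= 0]
     and [q - gmin i >= 0]. *)
  by rewrite !mul0r !mulr0 !addr0 max_l ?subr_le0 // min_l ?subr_ge0.
(* At 1 the constants cancel and both second arguments become [q]. *)
by rewrite !mul1r !mulr1 !addrK max_r // min_r.
Qed.
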